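(* (1) Let $G$ be a graph with at most $d$ parallel normal edges incident with the same pair of vertices and such that for every vertex, the number of semi-edges incident with it plus twice the number of loops incident with it is at most $q$. Then for every even number $p \ge \max\{d, q+1\}$ there exists a simple $p$-fold cover of $G$. (2) If, moreover, $G$ has no semi-edges, then a simple $p$-fold cover of $G$ exists for every $p \ge \max\{d, q+1\}$.
   Context: A graph has finite vertex and edge sets; every edge is a normal edge (two distinct end-vertices, adding 1 to each degree), a loop (one vertex, adding 2 to its degree) or a semi-edge (one vertex, adding 1 to its degree); multiple loops, semi-edges and parallel edges are allowed. A graph is simple if it has no loops, semi-edges or parallel normal edges. A covering projection from $G'$ to a graph $H$ is a pair of surjective maps $f_V:V(G')\to V(H)$, $f_E:E(G')\to E(H)$ with $f_V$ degree preserving, $f_E$ mapping semi-edges onto semi-edges and loops onto loops (normal edges may go to normal edges, loops or semi-edges), $f_E$ incidence preserving, and $f_E$ a local bijection between the edge-neighborhoods of each vertex and its image (so the preimage of a loop at $u$ is a disjoint union of cycles spanning $f_V^{-1}(u)$, the preimage of a semi-edge at $u$ consists of semi-edges and normal edges covering each vertex of $f_V^{-1}(u)$ exactly once, and the preimage of a normal edge $uv$ is a perfect matching between $f_V^{-1}(u)$ and $f_V^{-1}(v)$). A $p$-fold cover of $H$ is a graph $G'$ with a covering projection onto $H$ in which every vertex of $H$ has exactly $p$ preimages. *)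

(* Defs.v *)
From mathcomp Require Import all_boot.

Set Implicit Arguments.
Unset Strict Implicit.
Unset Printing Implicit Defensive.

Variant edge_kind := Normal | Loop | SemiEdge.

Record graph := Graph {
  vert : finType;
  edge : finType;
  kind : edge -> edge_kind;
  ends : edge -> {set vert};
  card_ends : forall e, #|ends e| = if kind e is Normal then 2 else 1
}.

Section Graph.
Variable G : graph.
Implicit Types (e : edge G) (v : vert G).

Definition is_normal e := if kind e is Normal then true else false.
Definition is_loop e := if kind e is Loop then true else false.
Definition is_semi e := if kind e is SemiEdge then true else false.

(* The contribution of [e] to the degree of [v]. *)
Definition mult e v : nat :=
  if v \in ends e then (if is_loop e then 2 else 1) else 0.

Definition degree v : nat := \sum_(e : edge G) mult e v.

(* The edge-neighborhood of [v], in which a loop at [v] occurs twice and every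
   other edge incident with [v] occurs once; the first component of an element
   is the underlying edge. *)
Definition edge_nbhd v := {e : edge G & 'I_(mult e v)}.

Definition n_parallel u v : nat :=
  #|[set e | is_normal e & ends e == [set u; v]]|.
Definition n_loops v : nat := #|[set e | is_loop e & v \in ends e]|.
Definition n_semi v : nat := #|[set e | is_semi e & v \in ends e]|.

Definition simple_graph : Prop :=
  [/\ forall e, ~~ is_loop e,
      forall e, ~~ is_semi e &
      forall e e', is_normal e -> is_normal e' -> ends e = ends e' -> e = e'].

End Graph.

(* As a loop counts twice in an edge-neighborhood, [cov_local_bij] lets two
   normal edges at [x] lie over the same loop at [fV x]. *)
Record covering_projection (G' H : graph)
    (fV : vert G' -> vert H) (fE : edge G' -> edge H) : Prop := {
  cov_surjV : forall u, exists x, fV x = u;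
  cov_surjE : forall e, exists e', fE e' = e;
  cov_degree : forall x, degree (fV x) = degree x;
  cov_semi : forall e', is_semi e' -> is_semi (fE e');
  cov_loop : forall e', is_loop e' -> is_loop (fE e');
  cov_incidence : forall e', ends (fE e') = fV @: ends e';
  cov_local_bij : forall x, exists phi : edge_nbhd x -> edge_nbhd (fV x),
    bijective phi /\ forall h, tag (phi h) = fE (tag h)
}.

Definition fold_cover (p : nat) (G' H : graph) : Prop :=
  exists (fV : vert G' -> vert H) (fE : edge G' -> edge H),
    covering_projection fV fE /\ forall u, #|[set x | fV x == u]| = p.

(* Main.v *)
Require Import Defs.
From mathcomp Require Import all_boot all_algebra zify.

(* Take [V(G) * 'I_p] as vertex set and lift each edge of [G] separately; the
   lifts have to be edge-disjoint. The r-th of the parallel edges [uv] is lifted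
   to the perfect matching joining [(u, a)] to [(v, b)] when [a + b = r] mod [p];
   as there are at most [p] of them, the matchings are disjoint. The loops and
   semi-edges at [v] are lifted inside the complete graph on [{v} * 'I_p]. For
   [p] even, it splits into [p - 1 >= q] perfect matchings: use one for each
   semi-edge and two for each loop. Without semi-edges, the r-th loop at [v]
   (counting from 0) is lifted to the edges joining [(v, a)] to
   [(v, a + (r + 1))]. *)

Set Implicit Arguments.
Unset Strict Implicit.
Unset Printing Implicit Defensive.

(** * Bijections from fibre counts; counting in edge-neighborhoods *)

(** The k-th element of each fibre of [f] goes to the k-th element of the fibre of [g] over the same
    point. This reduces the local bijection of a covering to a count of edges. *)
Lemma fibre_bijection (A B C : finType) (f : A -> C) (g : B -> C) :
  (forall c, #|[set a | f a == c]| = #|[set b | g b == c]|) ->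
  exists phi : A -> B, bijective phi /\ forall a, g (phi a) = f a.
Proof.
move=> fg.
have rkP a : a \in [set a' | f a' == f a] by rewrite inE.
pose phi a : B := enum_val (cast_ord (fg (f a)) (enum_rank_in (rkP a) a)).
have gphi a : g (phi a) = f a.
  by have := enum_valP (cast_ord (fg (f a)) (enum_rank_in (rkP a) a));
     rewrite inE => /eqP.
have phi_inj : injective phi.
  move=> a b eq_ab; have eq_f : f a = f b by rewrite -!gphi eq_ab.
  have aE c (ac : a \in [set a' | f a' == c]) (bc : b \in [set a' | f a' == c])
      : enum_val (cast_ord (fg c) (enum_rank_in ac a)) =
        enum_val (cast_ord (fg c) (enum_rank_in bc b)) -> a = b.
    move/enum_val_inj/cast_ord_inj => eq_r.
    by rewrite -(enum_rankK_in ac ac) eq_r enum_rankK_in.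
  by move: eq_ab; rewrite /phi; move: (rkP a) (rkP b); rewrite -eq_f; exact: aE.
(* Both cardinals are the sum of the fibre sizes, so injectivity suffices. *)
exists phi; split=> //; apply: inj_card_bij phi_inj _.
rewrite -[#|A|]sum1_card -[#|B|]sum1_card.
rewrite (partition_big f predT) //= (partition_big g predT) //=.
rewrite leq_eqVlt; apply/orP; left; apply/eqP; apply: eq_bigr => c _.
by rewrite !sum1dep_card fg.
Qed.

Lemma degree_edge_nbhd (H : graph) (v : vert H) : degree v = #|{: edge_nbhd v}|.
Proof.
rewrite card_tagged sumnE big_map big_enum /=.
by apply: eq_bigr => e _; rewrite card_ord.
Qed.

Lemma card_edge_nbhd_fibre (H : graph) (v : vert H) (e : edge H) :
  #|[set h : edge_nbhd v | tag h == e]| = mult e v.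
Proof.
pose t (i : 'I_(mult e v)) : edge_nbhd v := Tagged (fun e => 'I_(mult e v)) i.
have -> : [set h : edge_nbhd v | tag h == e] = [set t i | i in 'I_(mult e v)].
  apply/setP=> -[e' i]; rewrite inE /=; apply/eqP/imsetP => [eq_e|[j _ /(congr1 tag)]//].
  by move: i; rewrite eq_e => i; exists i.
by rewrite card_imset ?card_ord // => i j /eqP; rewrite eq_Tagged => /eqP.
Qed.

(** * Covers built from one relation on layers per edge *)

Section CoverOfRelations.
(** [Q e a b] is to mean that a lift of [e] joins layer [a] at one end to layer [b] at the other; as
    [ends e] is unordered, [Q e] must be symmetric. [Q_disj] also compares loops with semi-edges,
    both being lifted inside a single fibre. *)
Variables (G : graph) (p : nat) (Q : edge G -> rel 'I_p).
Hypothesis p_gt0 : 0 < p.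
Hypothesis Q_sym : forall e, symmetric (Q e).
Hypothesis Q_irr : forall e a, ~~ is_normal e -> ~~ Q e a a.
Hypothesis Q_deg : forall e a, #|[set b | Q e a b]| = if is_loop e then 2 else 1.
Hypothesis Q_disj : forall e f a b, is_normal e = is_normal f ->
  ends e = ends f -> Q e a b -> Q f a b -> e = f.

Local Notation V' := (vert G * 'I_p)%type.
Implicit Types (e f : edge G) (x y : V').

Let adj e x y := (ends e == [set x.1; y.1]) && Q e x.2 y.2.

Let card_ends_normal e : #|ends e| = (is_normal e).+1.
Proof. by rewrite card_ends /is_normal; case: (kind e). Qed.

Let adj_sym e : symmetric (adj e).
Proof. by move=> x y; rewrite /adj setUC Q_sym. Qed.

Let adj_irr e x : adj e x x = false.
Proof.
apply/negP=> /andP[/eqP E]; apply/negP/Q_irr; have := card_ends_normal e.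
by rewrite E setUid cards1; case: is_normal.
Qed.

Let adj_disj e f x y : adj e x y -> adj f x y -> e = f.
Proof.
move=> /andP[/eqP Ee Qe] /andP[/eqP Ef Qf]; apply: Q_disj Qe Qf.
- have := card_ends_normal f; rewrite Ef -Ee card_ends_normal.
  by do 2!case: is_normal.
- by rewrite Ee Ef.
Qed.

Let adj_deg e x : #|[set y | adj e x y]| = mult e x.1.
Proof.
rewrite /mult; case: ifP => [xe|/negP xe]; last first.
  apply/eqP; rewrite cards_eq0; apply/eqP/setP => y; rewrite !inE.
  by apply/negP => /andP[/eqP E _]; apply: xe; rewrite E !inE eqxx.
(* [w] is the other end of [e], or [x.1] itself when [e] is not normal. *)
have [w wE] : exists w, ends e = [set x.1; w].
  have := card_ends_normal e; case: is_normal => /eqP.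
    case/cards2P=> u [v [_ E]]; move: xe; rewrite E !inE.
    by case/orP=> /eqP ->; [exists v | exists u; rewrite setUC].
  case/cards1P=> u E; move: xe; rewrite E inE => /eqP ->.
  by exists u; rewrite setUid.
rewrite -(Q_deg e x.2).
rewrite -[RHS](card_imset _ (f := fun b => (w, b))); last by move=> ? ? [].
apply: eq_card => -[v b]; rewrite inE /adj /=; apply/andP/imsetP => /=.
  case=> /eqP E Qb; exists b; rewrite ?inE //; congr pair.
  have /setP Es : [set x.1; w] = [set x.1; v] by rewrite -wE.
  have := Es v; have := Es w; rewrite !inE !eqxx ?orbT /=.
  by case/esym/orP=> /eqP -> //; rewrite orbb => /eqP.
by case=> b'; rewrite inE => Qb [-> ->]; rewrite wE.
Qed.

(** The first component makes [fE] a projection; the second is an unordered pair, so the two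
    directions of a lift give one edge. *)
Let in_cover (eA : edge G * {set V'}) :=
  [exists x, exists y, (eA.2 == [set x; y]) && adj eA.1 x y].
Let cover_edge := {eA : edge G * {set V'} | in_cover eA}.

Let cover_edgeP (e' : cover_edge) :
  exists x y, (val e').2 = [set x; y] /\ adj (val e').1 x y.
Proof. by have /existsP[x /existsP[y /andP[/eqP ? ?]]] := valP e'; exists x, y. Qed.

Let cover_card_ends (e' : cover_edge) : #|(val e').2| = 2.
Proof.
have [x [y [-> xy]]] := cover_edgeP e'; rewrite cards2.
by case: eqP xy => // ->; rewrite adj_irr.
Qed.

Let cover := @Graph _ cover_edge (fun=> Normal)
  (fun e' : cover_edge => (val e').2) cover_card_ends.

Let fV (x : vert cover) : vert G := x.1.
Let fE (e' : edge cover) : edge G := (val e').1.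

Let cover_mult (e' : edge cover) (x : vert cover) : mult e' x = (x \in (val e').2).
Proof. by rewrite /mult /=; case: ifP. Qed.

Let adj_edge e x y (xy : adj e x y) : in_cover (e, [set x; y]).
Proof. by apply/existsP; exists x; apply/existsP; exists y; rewrite eqxx. Qed.

(** Both sides count the [y] with [adj e x y]: the right one by [adj_deg], the left one by sending
    [y] to the edge from [x] to [y] over [e]. *)
Let fibre_card (x : vert cover) (e : edge G) :
  #|[set h : edge_nbhd x | fE (tag h) == e]| = #|[set h : edge_nbhd (fV x) | tag h == e]|.
Proof.
rewrite card_edge_nbhd_fibre -adj_deg.
pose D := [set e' : edge cover | (fE e' == e) && (x \in (val e').2)].
have -> : #|[set h : edge_nbhd x | fE (tag h) == e]| = #|D|.
  (* Every cover edge is normal, so it contributes one element if it contains [x] and none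
     otherwise. *)
  rewrite -sum1dep_card (partition_big (fun h : edge_nbhd x => tag h)
    (fun e' : edge cover => fE e' == e)) //= -[RHS]sum1_card.
  rewrite [RHS](eq_bigl (fun e' : edge cover => (fE e' == e) && (x \in (val e').2))); last first.
    by move=> e'; rewrite inE.
  rewrite [RHS]big_mkcondr /=; apply: eq_bigr => e' /eqP He'.
  transitivity (@mult cover e' x); last by rewrite cover_mult; case: (_ \in _).
  rewrite -card_edge_nbhd_fibre -sum1dep_card; apply: eq_bigl => h.
  by apply: andb_idl => /eqP ->; rewrite He'.
rewrite -(card_imset _ val_inj).
have setx_inj : injective (fun y : V' => (e, [set x; y])).
  move=> y z [/setP E]; have := E y; have := E z; rewrite !inE !eqxx !orbT.
  by case/orP=> /eqP -> //; rewrite orbb => /esym/eqP.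
rewrite -[RHS](card_imset _ setx_inj); apply: eq_card => eA.
apply/imsetP/imsetP => [[e']|[y]]; rewrite inE.
  case/andP=> /eqP fe; have [y [z [E yz]]] := cover_edgeP e'.
  have eE : val e' = (e, [set y; z]) by rewrite [val e']surjective_pairing E -fe.
  rewrite -/(fE e') fe in yz; rewrite E !inE => /orP[] /eqP xE ->.
    by exists z; rewrite ?inE xE // eE.
  by exists y; rewrite ?inE xE 1?adj_sym // eE setUC.
move=> xy ->; exists (Sub (e, [set x; y]) (adj_edge xy)) => //.
by rewrite inE /fE /= eqxx !inE eqxx.
Qed.

Lemma simple_cover_of_rel :
  exists G' : graph, simple_graph G' /\ fold_cover p G' G.
Proof.
exists cover; split.
  split=> // e f _ _ /= eq_ef; apply: val_inj.
  have [x [y [Ee xy]]] := cover_edgeP e; have [z [t [Ef zt]]] := cover_edgeP f.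
  rewrite [LHS]surjective_pairing [RHS]surjective_pairing eq_ef; congr pair.
  (* The pairs agree directly or crosswise; [adj_irr] excludes degenerate pairs and [adj_sym] turns
     the crosswise case round. *)
  have /setP E : [set x; y] = [set z; t] by rewrite -Ee -Ef.
  have := E x; have := E y; have := E z; rewrite !inE !eqxx !orbT.
  move=> Hz Hy /esym Hx; case/orP: Hx => /eqP Ex.
    subst z; case/esym/orP: Hy => /eqP Ey; last by subst t; exact: adj_disj xy zt.
    by subst y; rewrite adj_irr in xy.
  subst t; case/orP: Hz => /eqP Ez; first by subst z; rewrite adj_irr in zt.
  by subst z; rewrite adj_sym in zt; exact: adj_disj xy zt.
exists fV, fE.
have locbij (x : vert cover) : exists phi : edge_nbhd x -> edge_nbhd (fV x),
    bijective phi /\ forall h, tag (phi h) = fE (tag h).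
  exact: (fibre_bijection (fibre_card x)).
split; first split => //.
- by move=> u; exists (u, Ordinal p_gt0).
- move=> e; have /card_gt0P[u ue] : 0 < #|ends e| by rewrite card_ends_normal.
  have : 0 < #|[set y | adj e (u, Ordinal p_gt0) y]|.
    by rewrite adj_deg /mult ue; case: is_loop.
  case/card_gt0P=> y; rewrite inE => xy.
  by exists (Sub (e, [set (u, Ordinal p_gt0); y]) (adj_edge xy)).
- move=> x; rewrite !degree_edge_nbhd.
  by have [phi [/bij_eq_card ->]] := locbij x.
- move=> e'; have [x [y [/= -> /andP[/eqP E _]]]] := cover_edgeP e'.
  by rewrite imsetU !imset_set1 -E.
move=> u; have -> : [set x | fV x == u] = [set (u, a) | a in 'I_p].
  apply/setP=> -[v a]; rewrite inE /fV /=; apply/eqP/imsetP => [->|[b _ [->]]//].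
  by exists a.
by rewrite card_imset ?card_ord // => a b [].
Qed.

End CoverOfRelations.

(** * Numbering the edges with the same ends *)

Section Rank.
Variables (G : graph) (P : pred (edge G)).
Implicit Types e f : edge G.

Definition same_ends e := [set f | P f & ends f == ends e].
Definition rank e := index e (enum (same_ends e)).

Lemma rank_lt e : P e -> rank e < #|same_ends e|.
Proof. by move=> Pe; rewrite cardE index_mem mem_enum inE Pe eqxx. Qed.

Lemma eq_same_ends e f : ends e = ends f -> same_ends e = same_ends f.
Proof. by rewrite /same_ends => ->. Qed.

(** Edges with equal ends are numbered by one common enumeration. *)
Lemma rank_inj e f : P e -> P f -> ends e = ends f -> rank e = rank f -> e = f.
Proof.
move=> Pe Pf E; rewrite /rank (eq_same_ends E).
by apply: (index_inj e); rewrite mem_enum inE ?Pe ?Pf ?E eqxx.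
Qed.

End Rank.

(** * Covers from colours; one-factorization of complete graphs *)

Section CoverOfColours.
Import GRing.Theory.
Local Open Scope ring_scope.

(* Colour [k] joins [a] to [act k a], and the same edge has colour [inv k] when
   seen from its other end. *)
Lemma simple_cover_of_colours (G : graph) (n : nat) (C : finType)
    (act : C -> 'I_n.+1 -> 'I_n.+1) (inv : C -> C) (K : edge G -> {set C}) :
  (forall e, is_normal e -> (#|same_ends (@is_normal G) e| <= n.+1)%N) ->
  (forall a, injective (act^~ a)) ->
  (forall k a, act (inv k) (act k a) = a) ->
  (forall e k a, ~~ is_normal e -> k \in K e -> act k a != a) ->
  (forall e k, ~~ is_normal e -> k \in K e -> inv k \in K e) ->
  (forall e, ~~ is_normal e -> #|K e| = if is_loop e then 2%N else 1%N) ->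
  (forall e f k, ~~ is_normal e -> ~~ is_normal f -> ends e = ends f ->
     k \in K e -> k \in K f -> e = f) ->
  exists G' : graph, simple_graph G' /\ fold_cover n.+1 G' G.
Proof.
move=> par_le act_inj actK act_irr K_inv K_card K_disj.
pose r e : 'I_n.+1 := inord (rank (@is_normal G) e).
(* The sum, unlike a difference, is symmetric in [a] and [b], which suits unordered ends. *)
pose Q (e : edge G) (a b : 'I_n.+1) :=
  if is_normal e then a + b == r e else b \in [set act k a | k in K e].
apply: (@simple_cover_of_rel G n.+1 Q) => //.
- have Qimp e a b : Q e a b -> Q e b a.
    rewrite /Q; case: ifPn => [_|eN]; first by rewrite addrC.
    case/imsetP=> k kK ->; apply/imsetP; exists (inv k); first exact: K_inv.
    by rewrite actK.
  by move=> e a b; apply/idP/idP; exact: Qimp.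
- move=> e a eN; rewrite /Q (negPf eN); apply/imsetP=> -[k kK aE].
  by have := act_irr e k a eN kK; rewrite -aE eqxx.
- move=> e a; rewrite /Q; case: (boolP (is_normal e)) => eN.
    have -> : is_loop e = false by move: eN; rewrite /is_normal /is_loop; case: (kind e).
    rewrite -(cards1 (r e - a)); apply: eq_card => b; rewrite !inE.
    by rewrite [RHS]eq_sym subr_eq eq_sym addrC.
  by rewrite -K_card // -(card_imset _ (act_inj a)); apply: eq_card => b; rewrite inE.
- move=> e f a b nef E; rewrite /Q -nef; case: ifPn => eN.
    have fN : is_normal f by rewrite -nef.
    (* Ranks stay below [n.+1], so [inord] keeps them distinct. *)
    move=> /eqP -> /eqP /(congr1 val); rewrite /= !inordK.
    + exact: rank_inj.
    + exact: leq_trans (rank_lt fN) (par_le _ fN).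
    + exact: leq_trans (rank_lt eN) (par_le _ eN).
  case/imsetP=> k kK -> /imsetP[l lK /act_inj klE].
  by apply: (K_disj e f k); rewrite -?nef // klE.
Qed.

(* The round-robin tournament: over [Z/n] plus a point at infinity [None], the
   colour [k] pairs [a] with [k - a], and the fixed point [k/2] with infinity. *)
Lemma one_factorization (n : nat) : odd n ->
  exists mate : 'I_n -> 'I_n.+1 -> 'I_n.+1,
    [/\ forall k, involutive (mate k), forall k a, mate k a != a
      & forall a, injective (mate^~ a)].
Proof.
case: n => [//|m] n_odd.
(* Doubling is injective modulo the odd number [m.+1], so every [k] has a unique half. *)
pose dbl (a : 'I_m.+1) := a + a.
have dbl_inj : injective dbl.
  have dbl0 (c : 'I_m.+1) : c + c = 0 -> c = 0.
    move/(congr1 val)/eqP; rewrite /= -/(_ %| _)%N addnn -mul2n.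
    rewrite Gauss_dvdr ?coprimen2 // => dvd_c; apply: val_inj => /=.
    by apply/eqP; rewrite -(modn_small (ltn_ord c)).
  move=> a b ab; apply/subr0_eq/dbl0.
  by rewrite addrACA -opprD; apply/eqP; rewrite subr_eq0 -/(dbl a) ab.
pose half := invF dbl_inj.
pose mo k (o : option 'I_m.+1) :=
  if o is Some a then if dbl a == k then None else Some (k - a) else Some (half k).
(* The element sent to infinity is exactly the fixed point of [k - a]. *)
have dbl_eq k a : (dbl a == k) = (k - a == a) by rewrite subr_eq eq_sym.
have mo_inv k : involutive (mo k).
  case=> [a|] /=; last by rewrite /half f_invF eqxx.
  case: eqP => [<-|/eqP ka] /=; first by rewrite /half invF_f.
  by rewrite dbl_eq subKr eq_sym -dbl_eq (negPf ka).
have mo_irr k o : mo k o != o.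
  case: o => [a|] //=; case: ifPn => //; rewrite dbl_eq.
  by apply: contra => /eqP/Some_inj ->.
have mo_inj o : injective (mo^~ o).
  case: o => [a|] k l /=; last first.
    by case=> /(congr1 dbl); rewrite !f_invF.
  by case: eqP => [<-|_]; case: eqP => // _ /Some_inj /addIr.
(* Infinity becomes the last ordinal. *)
pose of_opt (o : option 'I_m.+1) : 'I_m.+2 := if o is Some a then lift ord_max a else ord_max.
pose to_opt : 'I_m.+2 -> option 'I_m.+1 := unlift ord_max.
have of_optK : cancel of_opt to_opt.
  by case=> [a|]; rewrite /to_opt /= ?liftK ?unlift_none.
have to_optK : cancel to_opt of_opt.
  by move=> a; rewrite /to_opt; case: unliftP => [b|] ->.
exists (fun k a => of_opt (mo k (to_opt a))); split.
- by move=> k a; rewrite /= of_optK mo_inv to_optK.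
- by move=> k a; rewrite -{2}(to_optK a) (can_eq of_optK).
- by move=> a k l /(can_inj of_optK)/mo_inj.
Qed.

End CoverOfColours.

(** * Bounds on edges with the same ends, and the choice of colours *)

Lemma normalPn (G : graph) (e : edge G) : ~~ is_normal e = is_semi e || is_loop e.
Proof. by rewrite /is_normal /is_semi /is_loop; case: (kind e). Qed.

Lemma semiNloop (G : graph) (e : edge G) : is_semi e -> is_loop e = false.
Proof. by rewrite /is_semi /is_loop; case: (kind e). Qed.

Lemma card_same_ends_normal (G : graph) (d : nat) (e : edge G) :
  (forall u v : vert G, u != v -> n_parallel u v <= d) ->
  is_normal e -> #|same_ends (@is_normal G) e| <= d.
Proof.
move=> hd eN; have /eqP/cards2P[u [v [uv E]]] : #|ends e| = 2.
  by rewrite card_ends; move: eN; rewrite /is_normal; case: (kind e).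
by rewrite /same_ends E; exact: hd.
Qed.

(** The ends of [e] form a singleton [[set v]], so a non-normal edge has the same ends as [e]
    exactly when it is incident with [v]. *)
Lemma card_same_ends_nonnormal (G : graph) (q : nat) (e : edge G) :
  (forall v : vert G, n_semi v + 2 * n_loops v <= q) -> ~~ is_normal e ->
  #|same_ends (@is_semi G) e| + 2 * #|same_ends (@is_loop G) e| <= q.
Proof.
move=> hq eN.
have ends1 f : ~~ is_normal f -> exists v : vert G, ends f = [set v].
  move=> fN; apply/cards1P; rewrite card_ends.
  by move: fN; rewrite /is_normal; case: (kind f).
have [v E] := ends1 e eN.
have endsE f : ~~ is_normal f -> (ends f == ends e) = (v \in ends f).
  move=> /ends1[w ->]; rewrite E inE.
  by rewrite (inj_eq set1_inj) eq_sym.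
rewrite (leq_trans _ (hq v)) // /n_semi /n_loops /same_ends.
rewrite leq_add ?leq_mul //; apply: subset_leq_card; apply/subsetP=> f; rewrite !inE.
all: by case/andP=> fP; rewrite fP endsE // normalPn fP ?orbT.
Qed.

Theorem theorem1 (G : graph) (d q : nat)
    (hd : forall u v : vert G, u != v -> n_parallel u v <= d)
    (hq : forall v : vert G, n_semi v + 2 * n_loops v <= q) :
  (forall p : nat, ~~ odd p -> maxn d q.+1 <= p ->
     exists G' : graph, simple_graph G' /\ fold_cover p G' G) /\
  ((forall e : edge G, ~~ is_semi e) ->
   forall p : nat, maxn d q.+1 <= p ->
     exists G' : graph, simple_graph G' /\ fold_cover p G' G).
Proof.
pose rs := rank (@is_semi G); pose rl := rank (@is_loop G).
pose ns (e : edge G) := #|same_ends (@is_semi G) e|.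
pose nl (e : edge G) := #|same_ends (@is_loop G) e|.
have n_le e : ~~ is_normal e -> ns e + 2 * nl e <= q by exact: card_same_ends_nonnormal.
have par_le n e : maxn d q.+1 <= n -> is_normal e -> #|same_ends (@is_normal G) e| <= n.
  rewrite geq_max => /andP[dn _] eN.
  exact: leq_trans (card_same_ends_normal hd eN) dn.
have rl_lt e : is_loop e -> rl e < nl e by exact: rank_lt.
have rs_lt e : is_semi e -> rs e < ns e by exact: rank_lt.
split=> [p p_even p_ge|no_semi p p_ge]; have q_lt : q < p by lia.
  case: p p_even p_ge q_lt => [//|[|m]] // p_even p_ge q_lt.
  have n_odd : odd m.+1 by move: p_even; rewrite /= !negbK.
  have [mate [mateK mate_irr mate_inj]] := one_factorization n_odd.
  pose c i : 'I_m.+1 := inord i.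
  (* At each vertex the semi-edges take the first [ns e] colours and the loops consecutive pairs
     after them. All colours used are below [q], hence below [m.+1], and [inord] is exact. *)
  pose K e := if is_semi e then [set c (rs e)]
              else [set c (ns e + 2 * rl e); c (ns e + 2 * rl e).+1].
  have KP e k : ~~ is_normal e -> k \in K e ->
      is_semi e /\ k = rs e :> nat \/
      is_loop e /\ ns e + 2 * rl e <= k <= (ns e + 2 * rl e).+1.
    move=> eN; have := n_le e eN; rewrite /K; move: eN; rewrite normalPn.
    case: ifP => [eS _ n_leq|_ /= eL n_leq]; rewrite !inE.
      by move/eqP->; left; rewrite inordK //; have := rs_lt e eS; lia.
    have := rl_lt e eL => rl_le.
    by case/orP=> /eqP ->; right; rewrite inordK; lia.
  apply: (@simple_cover_of_colours G m.+1 _ mate id K) => //.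
  - by move=> e; apply: par_le.
  - move=> e eN; have := n_le e eN; rewrite /K; move: eN; rewrite normalPn.
    case: ifP => [eS _ _|_ /= eL n_leq]; first by rewrite semiNloop // cards1.
    have := rl_lt e eL => rl_le.
    rewrite eL cards2; case: eqP => // /(congr1 val) /=; rewrite !inordK; lia.
  - move=> e f k eN fN E /(KP e k eN) ke /(KP f k fN) kf.
    (* Equal ends give the same offset, so the colour blocks line up. *)
    have nsE : ns e = ns f by rewrite /ns (eq_same_ends _ E).
    case: ke kf => [] [eP ke] [] [fP kf].
    + by apply: (rank_inj eP fP E); rewrite -/rs -ke -kf.
    + by have := rs_lt e eP; lia.
    + by have := rs_lt f fP; lia.
    + by apply: (rank_inj eP fP E); rewrite -/rl; lia.
case: p p_ge q_lt => [//|n] p_ge q_lt.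
have loopP (e : edge G) : ~~ is_normal e -> is_loop e by rewrite normalPn (negPf (no_semi e)).
(* The shift starts at 1, since a zero shift would join a vertex to itself. *)
pose c (e : edge G) : 'I_n.+1 := inord (rl e).+1.
have cE e : ~~ is_normal e -> c e = (rl e).+1 :> nat /\ 2 * (rl e).+1 < n.+1.
  move=> eN; have := n_le e eN; have := rl_lt e (loopP e eN) => ? ?.
  by rewrite /c inordK; lia.
(* Each shift is positive and below half the modulus, so two of them sum to a nonzero residue: no
   shift is the opposite of itself or of another. *)
have cDn0 e f : ~~ is_normal e -> ~~ is_normal f -> (c e + c f != 0)%R.
  move=> eN fN; have [ce ?] := cE e eN; have [cf ?] := cE f fN.
  by apply/eqP => /(congr1 val) /=; rewrite ce cf modn_small; lia.
(* The two colours of a loop are its shift and the opposite one, the two directions along the lifted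
   cycles. *)
apply: (@simple_cover_of_colours G n _ (fun k a => a + k)%R -%R%R
          (fun e => [set c e; - c e]%R)) => //.
- by move=> e; apply: par_le.
- by move=> a; exact: GRing.addrI.
- by move=> k a; rewrite GRing.addrK.
- move=> e k a eN kK; have [ce _] := cE e eN.
  have k0 : (k != 0)%R.
    move: kK; rewrite !inE => /orP[] /eqP ->; rewrite ?GRing.oppr_eq0;
      by apply/eqP => /(congr1 val); rewrite /= ce.
  by rewrite -GRing.subr_eq0 GRing.addrC GRing.addKr.
- move=> e k eN; rewrite !inE GRing.eqr_oppLR GRing.eqr_opp.
  by rewrite orbC.
- by move=> e eN; rewrite loopP // cards2 -GRing.addr_eq0 cDn0.
- move=> e f k eN fN E.
  have c_inj : c e = c f -> e = f.
    move/(congr1 val) => /=; have [-> _] := cE e eN; have [-> _] := cE f fN.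
    by case; apply: rank_inj; rewrite ?loopP.
  rewrite !inE => /orP[] /eqP -> /orP[] /eqP.
  + exact: c_inj.
  + by move/eqP; rewrite -GRing.addr_eq0 (negPf (cDn0 e f _ _)).
  + by move/esym/eqP; rewrite -GRing.addr_eq0 (negPf (cDn0 f e _ _)).
  + by move/GRing.oppr_inj.
Qed.
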